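(* Let $(a_n)_{n=1}^\infty$ be a sequence of positive integers. The following are equivalent: (1) The sequence $(a_n)_{n=1}^\infty$ is bounded. (2) For every basis (of any $p$-Banach space, $0<p\leqslant 1$), the basis is $\mathcal F_{(a_n)}$-almost greedy if and only if it is almost greedy.
   Context: Let $\mathbb N=\{1,2,\dots\}$ and let $\mathbb N^{<\infty}$ be the collection of finite subsets of $\mathbb N$. A $p$-Banach space ($0<p\leqslant 1$) over $\mathbb F$ ($=\mathbb R$ or $\mathbb C$) is a vector space complete under a homogeneous, positive definite $\|\cdot\|$ with $\|x+y\|^p\leqslant\|x\|^p+\|y\|^p$. All spaces $X$ are separable and infinite dimensional; $X^*$ is the dual of $X$. A basis $\mathcal B$ of $X$ is a sequence $(e_n)_{n=1}^\infty\subset X$ whose span is dense in $X$, for which there is a unique sequence $(e_n^* )_n\subset X^*$ with $e_m^*(e_n)=\delta_{m,n}$ for all $m,n$, and such that $0<\inf_n\{\|e_n\|,\|e_n^*\|\}\leqslant\sup_n\{\|e_n\|,\|e_n^*\|\}<\infty$. For $A\in\mathbb N^{<\infty}$, $P_A(x)=\sum_{n\in A}e_n^*(x)e_n$. For $x\in X$ and an integer $m\geqslant 0$, $\Lambda_m(x)$ denotes any set with $|\Lambda_m(x)|=m$ and $\min_{n\in\Lambda_m(x)}|e_n^*(x)|\geqslant\max_{n\notin\Lambda_m(x)}|e_n^*(x)|$ (the choice need not be unique; $\Lambda_0(x)=\emptyset$), and $G_m(x)=P_{\Lambda_m(x)}(x)$. A basis is almost greedy if there is $C>0$ such that $\|x-G_m(x)\|\leqslant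 C\inf\{\|x-P_A(x)\|: A\subset\mathbb N,\ |A|=m\}$ for all $x\in X$, $m\in\mathbb N$ and all choices of $G_m(x)$. For a collection $\mathcal F$ of finite subsets of $\mathbb N$ with $\emptyset\in\mathcal F$, a basis is $\mathcal F$-almost greedy if there is $\Delta\geqslant 1$ such that $\|x-G_m(x)\|\leqslant\Delta\inf_{F\in\mathcal F,\,|F|\leqslant m}\|x-P_F(x)\|$ for all $x\in X$, $m\in\mathbb N$ and all choices of $G_m(x)$. $\mathcal F_{(a_n)}:=\{\emptyset\}\cup\{k+\{a_1,a_1+a_2,\dots,a_1+a_2+\cdots+a_\ell\}: k\geqslant 0,\ \ell\geqslant 1\}$ ($k,\ell$ integers), where $k+A=\{k+n:n\in A\}$. *)

(* Defs.v *)
From HB Require Import structures.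
From mathcomp Require Import all_boot all_order all_algebra.
From mathcomp Require Import finmap complex.
From mathcomp Require Import all_classical all_reals all_analysis.
Import Order.TTheory GRing.Theory Num.Theory.
Import numFieldNormedType.Exports.

Set Implicit Arguments.
Unset Strict Implicit.
Unset Printing Implicit Defensive.

Local Open Scope classical_set_scope.
Local Open Scope ring_scope.

Variant scalar_kind := RealScalars | ComplexScalars.

Definition scalars (R : realType) (F : scalar_kind) : fieldType :=
  match F with
  | RealScalars => R
  | ComplexScalars => R[i]
  end.

(* The modulus takes its values in R also for complex scalars, whereas the
   MathComp norm of R[i] is R[i]-valued. *)
Definition modulus (R : realType) (F : scalar_kind) : scalars R F -> R :=
  match F return scalars R F -> R with
  | RealScalars => fun z : R => `|z|
  | ComplexScalars => fun z : R[i] => complex.Re `|z|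
  end.

Record pBanachSpace (R : realType) (F : scalar_kind) (p : R) := PBanachSpace {
  carrier :> lmodType (scalars R F);
  pnorm : carrier -> R;
  pnorm_ge0 : forall x, 0 <= pnorm x;
  pnorm_eq0 : forall x, pnorm x = 0 -> x = 0;
  pnormZ : forall (c : scalars R F) x, pnorm (c *: x) = modulus c * pnorm x;
  pnormD : forall x y, pnorm (x + y) `^ p <= pnorm x `^ p + pnorm y `^ p;
  pnorm_complete : forall u : nat -> carrier,
    (forall eps : R, 0 < eps ->
       \forall m & n \near \oo, pnorm (u m - u n) < eps) ->
    exists l : carrier, (fun n => pnorm (u n - l)) @ \oo --> (0 : R)
}.

Section Bases.
Variables (R : realType) (F : scalar_kind) (p : R) (X : pBanachSpace F p).
Local Notation K := (scalars R F).
Implicit Types (x y : X) (e : nat -> X) (es fs : nat -> {scalar X}).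

Definition pdense (D : set X) : Prop :=
  forall x (eps : R), 0 < eps -> exists2 y, D y & pnorm (x - y) < eps.

Definition separable_space : Prop :=
  exists D : set X, countable D /\ pdense D.

Definition infinite_dimensional : Prop :=
  forall (n : nat) (v : 'I_n -> X),
    exists x, forall c : 'I_n -> K, x <> \sum_i c i *: v i.

Definition in_dual (f : {scalar X}) : Prop :=
  forall x (eps : R), 0 < eps ->
    exists2 delta : R, 0 < delta &
      forall y, pnorm (y - x) < delta -> modulus (f y - f x) < eps.

Definition dual_norm (f : {scalar X}) : \bar R :=
  ereal_sup [set (modulus (f x))%:E | x in [set x | pnorm x <= 1]].

Definition linear_span e : set X :=
  [set x | exists (n : nat) (c : nat -> K), x = \sum_(i < n) c i *: e i].

Definition biorthogonal_dual e es : Prop :=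
  (forall n, in_dual (es n)) /\ (forall m n, es m (e n) = (m == n)%:R).

Definition basis_norms e es : set (\bar R) :=
  range (fun n => (pnorm (e n))%:E) `|` range (fun n => dual_norm (es n)).

(* Sequences are indexed from 0: [e n] stands for e_{n+1}, and [es n] for
   e_{n+1}^*.  Finite sets of indices are shifted accordingly. *)
Definition is_basis e es : Prop :=
  [/\ pdense (linear_span e),
      biorthogonal_dual e es,
      forall fs, biorthogonal_dual e fs -> forall n, fs n =1 es n,
      (0 < ereal_inf (basis_norms e es))%E &
      (ereal_sup (basis_norms e es) < +oo)%E].

Definition coord_proj e es (A : {fset nat}) x : X := \sum_(n <- A) es n x *: e n.

Definition greedy_set es x (m : nat) (L : {fset nat}) : Prop :=
  #|` L|%fset = m /\
  forall i j, i \in L -> j \notin L -> modulus (es j x) <= modulus (es i x).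

Definition almost_greedy e es : Prop :=
  exists2 C : R, 0 < C &
    forall x (m : nat) (L : {fset nat}), (0 < m)%N -> greedy_set es x m L ->
      pnorm (x - coord_proj e es L x) <=
      C * inf [set pnorm (x - coord_proj e es A x) |
                 A in [set A : {fset nat} | #|` A|%fset = m]].

Definition family_almost_greedy (Fam : set {fset nat}) e es : Prop :=
  exists2 D : R, 1 <= D &
    forall x (m : nat) (L : {fset nat}), (0 < m)%N -> greedy_set es x m L ->
      pnorm (x - coord_proj e es L x) <=
      D * inf [set pnorm (x - coord_proj e es A x) |
                 A in [set A : {fset nat} | Fam A /\ (#|` A|%fset <= m)%N]].

End Bases.

(* [a j] stands for a_{j+1}.  The predecessor accounts for the shift of the
   index set {1, 2, ...} to nat; it never truncates when a_1 is positive. *)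
Definition gap_family (a : nat -> nat) : set {fset nat} :=
  [set A | A = fset0 \/
     exists k l : nat, (0 < l)%N /\
       A = [fset (k + \sum_(j < i.+1) a j).-1%N | i in iota 0 l]%fset].

(* Main.v *)
Require Import Defs.
From HB Require Import structures.
From mathcomp Require Import all_boot all_order all_algebra.
From mathcomp Require Import finmap complex.
From mathcomp Require Import all_classical all_reals all_analysis.
From mathcomp Require Import lra zify.
Import Order.TTheory GRing.Theory Num.Theory.
Import numFieldNormedType.Exports.

(** Write P_A for the coordinate projection on a finite set A, S for the set of
    partial sums of the gaps, and x_n for the coordinates of x.

    An almost greedy basis is almost greedy for every family containing the
    empty set ([almost_greedy_family]): a set A with fewer than m elements is
    completed to one with m elements far away, where x - P_A x has negligible
    coordinates ([far_proj_le]).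

    Suppose the gaps are bounded by M.  Then boundedly many translates of
    initial segments of S cover any given interval away from the origin, and
    there are segments of every cardinality arbitrarily far away.  These two
    facts suffice ([covering_family_almost_greedy]).  Let L be a greedy set of
    x, let A have the same cardinality, let y = x - P_A x and let t be the
    smallest modulus of a coordinate of x over L \ A.  Since
      x - P_L x = (y - P_(L \ A) y) + P_(A \ L) x
    and L \ A is a greedy set of y, the first term is controlled by comparison
    with the empty set, and what is left is to bound P_(A \ L) x, whose
    coordinates have modulus at most t, by y.  This goes through the flat vector
    t 1_E on a far member E of the family with |E| = |L \ A|:
    - t 1_E is controlled by y, because L \ A is still a greedy set of
      y - P_E y + t 1_E ([flat_le_greedy]);
    - a piece of A \ L contained in a member G of the family is controlled by
      t 1_E.  One fills up G \ A with the value t: then E and the filling form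
      a greedy set whose removal leaves exactly the piece, whereas the removal
      of G leaves t 1_E ([proj_le_flat]).
    Summing the p-th powers over the boundedly many members that cover A \ L
    finishes the argument.

    Suppose the gaps are unbounded.  Then long gaps allow one to choose an
    infinite set D with infinite complement that meets every translate of S in
    at most one point ([sparse_for_gap_family]).  Consider the c_0-like space
    with the norm max (sup_n |x_n|, sum_(n in D) |x_n|), which looks like l_1 on
    D and like c_0 off D.  Its unit vectors are not almost greedy, as the flat
    vector on m points of D has norm m and the one on m points off D has norm
    1 ([sparse_not_almost_greedy]).  But removing a member of the family changes
    at most one coordinate in D, so that the unit vectors are almost greedy for
    the family ([sparse_family_almost_greedy]).  *)

Set Implicit Arguments.
Unset Strict Implicit.
Unset Printing Implicit Defensive.

Local Open Scope classical_set_scope.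
Local Open Scope ring_scope.

(** * Scalars and p-norms *)

Section Modulus.
Variables (R : realType) (F : scalar_kind).
Local Notation K := (scalars R F).
Implicit Types (z w : K) (t : R).

Lemma modulus_ge0 z : 0 <= modulus z.
Proof.
by case: F z => z; [exact: normr_ge0|case: z => u v; exact: sqrtr_ge0].
Qed.

Lemma modulus0 : modulus (0 : K) = 0.
Proof.
by case: F; [exact: normr0|exact: ComplexField.Normc.normc0].
Qed.

Lemma modulus1 : modulus (1 : K) = 1.
Proof.
by case: F; [exact: normr1|exact: ComplexField.Normc.normc1].
Qed.

Lemma modulus0_eq0 z : modulus z = 0 -> z = 0.
Proof.
by case: F z => z; [exact: normr0_eq0|exact: ComplexField.Normc.eq0_normc].
Qed.

Lemma modulusM z w : modulus (z * w) = modulus z * modulus w.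
Proof.
by case: F z w => z w; [exact: normrM|exact: ComplexField.Normc.normcM].
Qed.

Lemma modulusD z w : modulus (z + w) <= modulus z + modulus w.
Proof. by case: F z w => z w; [exact: ler_normD|exact: le_normcD]. Qed.

Lemma modulusN z : modulus (- z) = modulus z.
Proof. by case: F z => z; [exact: normrN|exact: normcN]. Qed.

Lemma modulus_gt0 z : z != 0 -> 0 < modulus z.
Proof.
move=> z0; rewrite lt_def modulus_ge0 andbT.
by apply: contra_neq z0; exact: modulus0_eq0.
Qed.

Lemma modulusV z : modulus z^-1 = (modulus z)^-1.
Proof.
have [->|z0] := eqVneq z 0; first by rewrite invr0 modulus0 invr0.
apply: (mulfI (lt0r_neq0 (modulus_gt0 z0))).
by rewrite -modulusM !divff ?modulus1 // lt0r_neq0 // modulus_gt0.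
Qed.

Definition real_scalar : R -> K :=
  match F return R -> scalars R F with
  | RealScalars => fun t => t
  | ComplexScalars => fun t => t%:C%C
  end.

Lemma modulus_real t : modulus (real_scalar t) = `|t|.
Proof.
rewrite /real_scalar; case: F => //=.
by rewrite -[RHS]sqrtr_sqr expr0n /= addr0.
Qed.

End Modulus.

Lemma le_inf_image (R : realType) (T : Type) (S : set T) (f : T -> R) (c y : R) :
  0 < c -> S !=set0 -> (forall s, S s -> y <= c * f s) ->
  y <= c * inf [set f s | s in S].
Proof.
move=> c0 [s0 Ss0] h; rewrite mulrC -ler_pdivrMr //.
apply: lb_le_inf; first by exists (f s0), s0.
by move=> _ [s Ss <-]; rewrite ler_pdivrMr // mulrC h.
Qed.

Lemma inf_image_le (R : realType) (T : Type) (S : set T) (f : T -> R) s :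
  (forall s, 0 <= f s) -> S s -> inf [set f s | s in S] <= f s.
Proof.
move=> f0 Ss; apply: ge_inf; last by exists s.
by exists 0 => _ [s' _ <-].
Qed.

Section PNorm.
Variables (R : realType) (F : scalar_kind) (p : R) (p0 : 0 < p).
Variables (X : pBanachSpace F p).
Local Notation K := (scalars R F).
Implicit Types (x y z : X).

Lemma pnorm0 : pnorm (0 : X) = 0.
Proof. by rewrite -(scale0r 0) pnormZ modulus0 mul0r. Qed.

Lemma pnormN x : pnorm (- x) = pnorm x.
Proof. by rewrite -scaleN1r pnormZ modulusN modulus1 mul1r. Qed.

(** The p-th power of the p-norm is subadditive; estimates are made for it and
    turned into estimates for the norm only at the end. *)
Definition ppow x := pnorm x `^ p.

Lemma ppow_ge0 x : 0 <= ppow x.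
Proof. exact: powR_ge0. Qed.

Lemma ppow0 : ppow 0 = 0.
Proof. by rewrite /ppow pnorm0 powR0 // gt_eqF. Qed.

Lemma ppowN x : ppow (- x) = ppow x.
Proof. by rewrite /ppow pnormN. Qed.

Lemma ppowD x y : ppow (x + y) <= ppow x + ppow y.
Proof. exact: pnormD. Qed.

Lemma ppowB x y : ppow (x - y) <= ppow x + ppow y.
Proof. by rewrite -(ppowN y) ppowD. Qed.

Lemma ppow_sum (I : Type) (r : seq I) (P : pred I) (f : I -> X) :
  ppow (\sum_(i <- r | P i) f i) <= \sum_(i <- r | P i) ppow (f i).
Proof.
elim/big_ind2 : _ => //; first by rewrite ppow0.
by move=> z s w t zs wt; apply: le_trans (ppowD _ _) (lerD zs wt).
Qed.

Lemma ppow_leP (c : R) x y : 0 <= c ->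
  (ppow x <= c `^ p * ppow y) = (pnorm x <= c * pnorm y).
Proof.
move=> c0; rewrite /ppow -powRM ?pnorm_ge0 //.
apply/idP/idP => h; last first.
  by apply: ge0_ler_powR => //; rewrite ?ltW // nnegrE ?mulr_ge0 ?pnorm_ge0.
rewrite leNgt; apply: contraTN h => h; rewrite -ltNge.
by apply: gt0_ltr_powR => //; rewrite nnegrE ?mulr_ge0 ?pnorm_ge0.
Qed.

Lemma ppow_le_pnorm (c : R) x y : 0 <= c ->
  ppow x <= c * ppow y -> pnorm x <= c `^ p^-1 * pnorm y.
Proof.
move=> c0 h; rewrite -ppow_leP ?powR_ge0 //.
by rewrite -powRrM mulVf ?gt_eqF // powRr1.
Qed.

End PNorm.

(** * Coordinates and finite combinations *)

Section Basis.
Variables (R : realType) (F : scalar_kind) (p : R) (p0 : 0 < p).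
Variables (X : pBanachSpace F p) (e : nat -> X) (es : nat -> {scalar X}).
Local Notation K := (scalars R F).
Implicit Types (x y : X) (A B L : {fset nat}).

Lemma basis_bound : is_basis e es -> exists2 b : R, 0 < b &
  forall n, pnorm (e n) <= b /\ forall x, modulus (es n x) <= b * pnorm x.
Proof.
case=> _ _ _ _ ltb.
have ub : forall s, basis_norms e es s ->
    (s <= ereal_sup (basis_norms e es))%E.
  exact: ereal_sup_ubound.
have lb0 : (0 <= ereal_sup (basis_norms e es))%E.
  apply: le_trans (ub (pnorm (e 0%N))%:E _); first by rewrite lee_fin pnorm_ge0.
  by left; exists 0%N.
move: ltb lb0 ub; case: (ereal_sup _) => [b||] // _; rewrite lee_fin => b0 ub.
exists (b + 1); first by rewrite ltr_wpDl.
move=> n; split.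
  have := ub (pnorm (e n))%:E; rewrite lee_fin => h.
  by rewrite (le_trans (h _)) ?lerDl //; left; exists n.
move=> x; have [x0|x0] := eqVneq (pnorm x) 0.
  by rewrite (pnorm_eq0 x0) linear0 modulus0 mulr_ge0 ?pnorm_ge0 ?addr_ge0.
have px : 0 < pnorm x by rewrite lt_def x0 pnorm_ge0.
pose y := real_scalar F (pnorm x)^-1 *: x.
have y1 : pnorm y <= 1.
  by rewrite pnormZ modulus_real ger0_norm ?invr_ge0 ?pnorm_ge0 // mulVf.
have : modulus (es n y) <= b.
  rewrite -lee_fin; apply: (@le_trans _ _ (dual_norm (es n))).
    by apply: ereal_sup_ubound; exists y.
  by apply: ub; right; exists n.
rewrite linearZ /= modulusM modulus_real ger0_norm ?invr_ge0 ?pnorm_ge0 //.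
rewrite mulrC ler_pdivrMr // => /le_trans; apply.
by rewrite ler_wpM2r ?pnorm_ge0 // lerDl.
Qed.

(** Coordinate projections are the combinations whose coefficients are the
    coordinates of a fixed vector; arbitrary coefficients serve to build test
    vectors. *)
Definition comb A (c : nat -> K) : X := \sum_(n <- A) c n *: e n.

Lemma combID B A c : comb A c = comb (A `&` B)%fset c + comb (A `\` B)%fset c.
Proof.
rewrite /comb (big_fsetID _ (mem B)) /=; congr (_ + _); apply: eq_fbigl => i.
  by rewrite !inE.
by rewrite !inE andbC.
Qed.

Lemma combB A B c : (B `<=` A)%fset ->
  comb A c - comb B c = comb (A `\` B)%fset c.
Proof. by move=> /fsetIidPr BA; rewrite (combID B A) BA addrC addKr. Qed.

Lemma eq_comb A c d : {in A, c =1 d} -> comb A c = comb A d.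
Proof. by move=> cd; apply: eq_fbigr => n nA _; rewrite cd. Qed.

Lemma comb0 c : comb fset0 c = 0.
Proof. by rewrite /comb big_seq_fset0. Qed.

Hypothesis biorth : forall m n, es m (e n) = (m == n)%:R.

Lemma coord_comb j A c : es j (comb A c) = if j \in A then c j else 0.
Proof.
rewrite /comb linear_sum /=.
under eq_bigr do rewrite linearZ /= biorth.
case: ifPn => jA.
  rewrite (big_fsetD1 j) //= eqxx mulr1 big1_fset ?addr0 // => i.
  by rewrite !inE eq_sym => /andP[/negbTE -> _] _; rewrite mulr0.
rewrite big1_fset // => i iA _.
by have [ji|] := eqVneq j i; [rewrite ji iA in jA|rewrite mulr0].
Qed.

Lemma coord_projE A x : coord_proj e es A x = comb A (fun n => es n x).
Proof. by []. Qed.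

Lemma coord_proj_comb A B c : (B `<=` A)%fset ->
  coord_proj e es B (comb A c) = comb B c.
Proof.
move=> BA; apply: eq_comb => n nB.
by rewrite coord_comb (fsubsetP BA).
Qed.

Lemma coord_sub_proj j A x :
  es j (x - coord_proj e es A x) = if j \in A then 0 else es j x.
Proof.
rewrite linearB /= coord_comb; case: ifP; by rewrite ?subrr ?subr0.
Qed.

Variables (b : R) (b0 : 0 < b).
Hypothesis e_le : forall n, pnorm (e n) <= b.
Hypothesis es_le : forall n x, modulus (es n x) <= b * pnorm x.

Lemma ppow_comb A c t : (forall n, n \in A -> modulus (c n) <= t) ->
  ppow (comb A c) <= #|` A|%:R * (t * b) `^ p.
Proof.
move=> ct; apply: (le_trans (ppow_sum p0 _ _ _)).
rewrite mulr_natl -iter_addr_0 -[#|` A|]count_predT -big_const_seq.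
rewrite big_seq [leRHS]big_seq.
apply: ler_sum => n nA; rewrite /ppow pnormZ.
apply: ge0_ler_powR; rewrite ?nnegrE ?(ltW p0) ?mulr_ge0 ?modulus_ge0 ?pnorm_ge0 //.
- by rewrite (le_trans (modulus_ge0 (c n))) ?ct.
- exact: ltW.
- by rewrite ler_pM ?modulus_ge0 ?pnorm_ge0 ?ct.
Qed.

Hypothesis dens : pdense (linear_span e).

(** The coordinates vanish eventually on the span of the basis, and the
    coordinate functionals are uniformly bounded. *)
Lemma coord_null x eps : 0 < eps ->
  exists N, forall n, (N <= n)%N -> modulus (es n x) < eps.
Proof.
move=> eps0; have eb : 0 < eps / b by rewrite divr_gt0.
have [_ [N [c ->]] xy] := dens x eb.
set y := \sum_(_ < _) _ in xy.
exists N => n Nn; have -> : es n x = es n (x - y).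
  rewrite linearB /= [es n y]linear_sum /= big1 ?subr0 // => i _.
  rewrite linearZ /= biorth gtn_eqF ?mulr0 //.
  exact: leq_trans (ltn_ord i) Nn.
apply: (le_lt_trans (es_le _ _)).
by rewrite mulrC -ltr_pdivlMr.
Qed.

(** Projections on sets of bounded cardinality become negligible far away.
    The bound is by x itself, rather than by a small constant, so as to make
    sense for x = 0 too. *)
Lemma far_proj_le x r : exists N, forall A,
  (#|` A| <= r)%N -> (forall n, n \in A -> (N <= n)%N) ->
  ppow (coord_proj e es A x) <= ppow x.
Proof.
have [x0|x0] := eqVneq (pnorm x) 0.
  exists 0%N => A _ _; rewrite coord_projE (_ : comb _ _ = 0) ?ppow0 ?ppow_ge0 //.
  by rewrite /comb big1 // => n _; rewrite (pnorm_eq0 x0) linear0 scale0r.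
have x_gt0 : 0 < pnorm x by rewrite lt_def x0 pnorm_ge0.
(* a coordinate of size t contributes at most (t b)^p to the p-th power of
   the norm, so that r coordinates below this t together stay under it *)
pose t := pnorm x / b / (r.+1%:R `^ p^-1).
have r0 : 0 < r.+1%:R `^ p^-1 :> R by rewrite powR_gt0.
have t0 : 0 < t by rewrite !divr_gt0.
have [N Nx] := coord_null x t0; exists N => A Ar NA.
have /le_trans : ppow (comb A (fun n => es n x)) <= #|` A|%:R * (t * b) `^ p.
  by apply: ppow_comb => n /NA /Nx /ltW.
apply; have -> : (t * b) `^ p = ppow x / r.+1%:R.
  rewrite /t mulrAC divfK ?gt_eqF // /ppow.
  rewrite powRM ?pnorm_ge0 ?invr_ge0 ?powR_ge0 //; congr (_ * _).
  rewrite -powR_inv1 ?powR_ge0 // -powRrM -powRrM mulN1r mulrN mulVf ?gt_eqF //.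
  by rewrite powR_inv1.
rewrite mulrCA ler_piMr ?ppow_ge0 // ler_pdivrMr // mul1r ler_nat.
exact: leqW.
Qed.

Lemma eq_proj_sub A B x : [disjoint A & B]%fset ->
  coord_proj e es B (x - coord_proj e es A x) = coord_proj e es B x.
Proof.
move=> dAB; apply: eq_comb => n nB; rewrite coord_sub_proj.
case: ifPn => // nA.
by have /fdisjointP/(_ _ nA) := dAB; rewrite nB.
Qed.

End Basis.

(** * From almost greedy to family almost greedy, and back *)

Lemma seq_argmin (R : realType) (T : eqType) (f : T -> R) (s : seq T) :
  s != [::] -> exists2 i, i \in s & forall j, j \in s -> f i <= f j.
Proof.
elim: s => [//|i [|k s] IH] _.
  by exists i; rewrite ?mem_head // => j; rewrite inE => /eqP ->.
have [//|l ls lmin] := IH.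
have [il|li] := leP (f i) (f l).
  exists i; first exact: mem_head.
  move=> j; rewrite inE => /predU1P[-> //|/lmin]; exact: le_trans.
exists l; first by rewrite inE ls orbT.
by move=> j; rewrite inE => /predU1P[->|/lmin //]; exact: ltW.
Qed.

Lemma seq_nat_bound (s : seq nat) : exists N, forall n, n \in s -> (n < N)%N.
Proof.
exists (\max_(n <- s) n).+1 => n ns.
by rewrite ltnS (big_rem n) //= leq_max leqnn.
Qed.

Section GreedyProperties.
Variables (R : realType) (F : scalar_kind) (p : R) (p0 : 0 < p).
Variables (X : pBanachSpace F p) (e : nat -> X) (es : nat -> {scalar X}).
Hypothesis bas : is_basis e es.
Local Notation K := (scalars R F).
Local Notation P := (coord_proj e es).
Implicit Types (x y : X) (A B E L G : {fset nat}) (Fam : set {fset nat}).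

Let biorth m n : es m (e n) = (m == n)%:R.
Proof. by case: bas => _ [_ ->]. Qed.

(** Competitors with fewer elements than the greedy set are harmless: they can
    be completed far away at the price of a factor 2 in the p-th power. *)
Lemma almost_greedy_family Fam :
  Fam fset0 -> almost_greedy e es -> family_almost_greedy Fam e es.
Proof.
move=> Fam0 [C C0 agC].
have [b b0 ebP] := basis_bound bas.
have [e_le es_le] := all_and2 ebP.
have dens : pdense (linear_span e) by case: bas.
exists (Num.max 1 (2 * C `^ p) `^ p^-1).
  rewrite [leLHS](_ : _ = 1 `^ p^-1); last by rewrite powR1.
  by rewrite ge0_ler_powR ?nnegrE ?invr_ge0 ?(ltW p0) // le_max lexx.
move=> x m L m0 greL.
have M0 : 0 < Num.max 1 (2 * C `^ p) by rewrite lt_max ltr01.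
apply: le_inf_image; rewrite ?powR_gt0 //; first by exists fset0; split.
move=> A [_ Am]; apply: (ppow_le_pnorm p0 (ltW M0)).
apply: (@le_trans _ _ (2 * C `^ p * ppow (x - P A x))); last first.
  by rewrite ler_wpM2r ?ppow_ge0 // le_max lexx orbT.
(* pad A with far indices, where x is negligible, to reach cardinality m *)
pose y := x - P A x.
have [N farN] := far_proj_le p0 biorth b0 e_le es_le dens y (m - #|` A|).
pose N' := maxn N (\max_(n <- A) n).+1.
pose E := [fset n in iota N' (m - #|` A|)]%fset.
have cE : #|` E| = (m - #|` A|)%N.
  by rewrite card_fseq undup_id ?iota_uniq // size_iota.
have NE n : n \in E -> (N' <= n)%N by rewrite !inE /= mem_iota => /andP[].
have dAE : [disjoint A & E]%fset.
  apply/fdisjointP => n nA; apply/negP => /NE; apply/negP; rewrite -ltnNge.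
  rewrite /N' leq_max ltnS; apply/orP; right.
  by rewrite (big_rem n) //= leq_max leqnn.
have yE : ppow (P E y) <= ppow y.
  by apply: farN; [rewrite cE|move=> n /NE; rewrite geq_max => /andP[]].
have PAE : x - P (A `|` E)%fset x = y - P E y.
  rewrite eq_proj_sub // /y coord_projE (combID _ A).
  have -> : ((A `|` E) `&` A = A)%fset by rewrite fsetIC fsetKU.
  have -> : ((A `|` E) `\` A = E)%fset.
    by rewrite fsetDUl fsetDv fset0U; apply/fsetDidPl; rewrite fdisjoint_sym.
  by rewrite opprD addrA.
have cAE : #|` (A `|` E)%fset| = m.
  rewrite cardfsU (disjoint_fsetI0 dAE) cardfs0 subn0 cE subnKC //.
apply: (@le_trans _ _ (C `^ p * ppow (x - P (A `|` E)%fset x))).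
  rewrite ppow_leP //; last exact: ltW.
  apply: le_trans (agC _ _ _ m0 greL) _; rewrite ler_wpM2l ?(ltW C0) //.
  apply: (inf_image_le (f := fun B => pnorm (x - P B x))) => //.
  by move=> ?; exact: pnorm_ge0.
rewrite PAE mulrAC mulrC ler_wpM2r ?powR_ge0 //.
by rewrite (le_trans (ppowB _ _)) // mulr_natl mulr2n lerD2l.
Qed.

Section FamilyGreedy.
Variables (Fam : set {fset nat}) (d : R).
Hypothesis Fam0 : Fam fset0.
Hypothesis fag : forall x L A, (0 < #|` L|)%N -> greedy_set es x #|` L| L ->
  Fam A -> (#|` A| <= #|` L|)%N -> ppow (x - P L x) <= d * ppow (x - P A x).

Local Notation flat E t := (comb e E (fun=> real_scalar F t)).

(** Fill G up with the value t and add a flat part on E.  As no coordinate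
    exceeds t in modulus, E together with the filling is a greedy set; removing
    it leaves the part on A, and removing G instead leaves the flat part. *)
Lemma proj_le_flat x t E A G : Fam G -> (A `<=` G)%fset ->
  [disjoint E & G]%fset -> (0 < #|` E|)%N -> (#|` A| <= #|` E|)%N ->
  0 <= t -> (forall n, n \in A -> modulus (es n x) <= t) ->
  ppow (P A x) <= d * ppow (flat E t).
Proof.
move=> FG AG dEG E0 AE t0 xt.
pose c n := if n \in A then es n x else real_scalar F t.
pose z := comb e (E `|` G)%fset c; pose L := ((E `|` G) `\` A)%fset.
have dEA n : n \in E -> n \notin A.
  by move=> nE; apply: contra (fdisjointP dEG n nE); exact: (fsubsetP AG).
have cL : #|` L| = (#|` E| + (#|` G| - #|` A|))%N.
  rewrite cardfsDS ?(fsubset_trans AG) ?fsubsetUr // cardfsU.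
  rewrite (disjoint_fsetI0 dEG) cardfs0 subn0 addnBA //.
  exact: fsubset_leq_card.
have cAG := fsubset_leq_card AG.
have zA : z - P L z = P A x.
  rewrite coord_proj_comb ?fsubsetDl // combB ?fsubsetDl //.
  have -> : ((E `|` G) `\` L = A)%fset.
    by rewrite /L fsetDK // (fsubset_trans AG) // fsubsetUr.
  by apply: eq_comb => n; rewrite /c => ->.
have zE : z - P G z = flat E t.
  rewrite coord_proj_comb ?fsubsetUr // combB ?fsubsetUr //.
  have -> : ((E `|` G) `\` G = E)%fset.
    by rewrite fsetDUl fsetDv fsetU0; apply/fsetDidPl.
  by apply: eq_comb => n /dEA; rewrite /c => /negbTE ->.
rewrite -zA -zE; apply: fag => //; first by rewrite cL addn_gt0 E0.
- split=> // i j iL jL; rewrite !coord_comb //.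
  move: iL; rewrite !inE => /andP[/negbTE iA iEG].
  rewrite iEG {2}/c iA modulus_real ger0_norm //.
  case: ifPn; rewrite ?modulus0 // => jEG; rewrite /c.
  move: jL; rewrite !inE in jEG *; rewrite jEG andbT negbK => jA.
  by rewrite jA xt.
- rewrite cL; lia.
Qed.

(** L is a greedy set both of y - P_E y, to be compared with the empty set, and
    of y - P_E y + t 1_E, to be compared with E.  Both comparisons have the
    same right-hand side, and the difference of the two remainders is t 1_E. *)
Lemma flat_le_greedy y t L E : Fam E -> (#|` E| <= #|` L|)%N ->
  [disjoint E & L]%fset -> (0 < #|` L|)%N -> 0 <= t ->
  (forall i, i \in L -> t <= modulus (es i y)) ->
  (forall j, j \notin L -> modulus (es j y) <= t) ->
  ppow (flat E t) <= 2 * d * ppow (y - P E y).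
Proof.
move=> FE EL dEL L0 t0 Lt yt.
pose w := y - P E y; pose z := w + flat E t.
have wE j : es j w = if j \in E then 0 else es j y by exact: coord_sub_proj.
have zE j : es j z = if j \in E then real_scalar F t else es j y.
  by rewrite linearD /= wE coord_comb //; case: ifP; rewrite ?add0r ?addr0.
have LE i : i \in L -> i \in E = false.
  move=> iL; apply: contraTF iL => iE.
  exact: (fdisjointP dEL).
have wL : ppow (w - P L w) <= d * ppow w.
  rewrite [X in d * ppow X](_ : w = w - P fset0 w); last first.
    by rewrite coord_projE comb0 subr0.
  apply: fag => //.
  split=> // i j iL jL; rewrite !wE (LE _ iL).
  case: ifP => _; rewrite ?modulus0 ?modulus_ge0 //.
  exact: le_trans (yt _ jL) (Lt _ iL).
have zL : ppow (z - P L z) <= d * ppow w.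
  have -> : w = z - P E z.
    rewrite /z [P E _](_ : _ = flat E t) ?addrK //.
    by apply: eq_comb => n nE; rewrite -/z zE nE.
  apply: fag => //; split=> // i j iL jL; rewrite !zE (LE _ iL).
  case: ifP; rewrite ?modulus_real ?ger0_norm ?Lt // => _.
  exact: le_trans (yt _ jL) (Lt _ iL).
have PLE : P L w = P L z.
  by apply: eq_comb => n nL; rewrite wE zE LE.
have -> : flat E t = (z - P L z) - (w - P L w).
  by rewrite PLE /z opprB addrA subrK addrC addKr.
apply: (le_trans (ppowB _ _)); rewrite -mulrA mulr_natl mulr2n.
exact: lerD.
Qed.

(** Subadditivity over a cover; the hypothesis is made on all subsets of the
    members because the pieces have to be made disjoint. *)
Lemma ppow_proj_cover x c (Gs : seq {fset nat}) B :
  (forall n, n \in B -> has (fun G => n \in G) Gs) ->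
  (forall G A, G \in Gs -> (A `<=` G)%fset -> (A `<=` B)%fset ->
    ppow (P A x) <= c) ->
  ppow (P B x) <= (size Gs)%:R * c.
Proof.
elim: Gs B => [|G Gs IH] B cov le_c.
  rewrite mul0r (_ : B = fset0) ?coord_projE ?comb0 ?ppow0 //.
  by apply/eqP/fset0Pn => -[n /cov].
rewrite coord_projE (combID _ G) (le_trans (ppowD _ _)) //.
rewrite /= -natr1 mulrDl mul1r addrC lerD //.
  apply: IH => [n|G' A G'Gs AG' AB].
    by rewrite !inE => /andP[/negbTE nG /cov] /=; rewrite nG.
  apply: (le_c G') => //; first by rewrite inE G'Gs orbT.
  exact: fsubset_trans AB (fsubsetDl _ _).
by apply: (le_c G); rewrite ?mem_head ?fsubsetIr ?fsubsetIl.
Qed.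

End FamilyGreedy.

(** The indices below n0 are not covered, but they are finitely many, so the
    boundedness of the basis takes care of them. *)
Lemma covering_family_almost_greedy Fam (n0 K0 : nat) :
  Fam fset0 ->
  (forall r N, (0 < r)%N -> exists E, [/\ Fam E, #|` E| = r &
     forall n, n \in E -> (N <= n)%N]) ->
  (forall N, exists Gs : seq {fset nat}, [/\ (size Gs <= K0)%N,
     forall G, G \in Gs -> Fam G &
     forall n, (n0 <= n < N)%N -> has (fun G => n \in G) Gs]) ->
  family_almost_greedy Fam e es -> almost_greedy e es.
Proof.
move=> Fam0 far cov [D D1 agD].
have [b b0 ebP] := basis_bound bas.
have [e_le es_le] := all_and2 ebP.
have dens : pdense (linear_span e) by case: bas.
have D0 : 0 <= D by apply: le_trans D1.
pose d := D `^ p.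
have d1 : 1 <= d.
  rewrite [leLHS](_ : _ = 1 `^ p); last by rewrite powR1.
  by rewrite ge0_ler_powR ?nnegrE ?(ltW p0).
have d0 : 0 <= d by exact: le_trans d1.
have fag x L A : (0 < #|` L|)%N -> greedy_set es x #|` L| L ->
    Fam A -> (#|` A| <= #|` L|)%N -> ppow (x - P L x) <= d * ppow (x - P A x).
  move=> L0 greL FA AL; rewrite ppow_leP //.
  apply: le_trans (agD _ _ _ L0 greL) _; rewrite ler_wpM2l //.
  apply: (inf_image_le (f := fun B => pnorm (x - P B x))) => //.
  by move=> ?; exact: pnorm_ge0.
pose c1 := (b * b) `^ p + d * (2 * d * 2).
have c10 : 0 <= c1 by rewrite addr_ge0 ?powR_ge0 ?mulr_ge0.
pose c := d + (n0 + K0)%:R * c1.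
have dc : d <= c by rewrite lerDl mulr_ge0.
have c0 : 0 < c by rewrite (lt_le_trans _ (le_trans d1 dc)).
exists (c `^ p^-1); first by rewrite powR_gt0.
move=> x m L m0 [Lm greL].
apply: le_inf_image; rewrite ?powR_gt0 //; first by exists L.
move=> A /= Am; apply: (ppow_le_pnorm p0 (ltW c0)).
pose L' := (L `\` A)%fset; pose A' := (A `\` L)%fset; pose y := x - P A x.
have [L'0|L'0] := eqVneq L' fset0.
  have <- : L = A.
    by apply/eqP; rewrite eqEfcard Am Lm leqnn andbT -fsetD_eq0; apply/eqP.
  by rewrite ler_peMl ?ppow_ge0 // (le_trans d1).
have [i0 i0L' i0min] : exists2 i, i \in L' &
    forall j, j \in L' -> modulus (es i x) <= modulus (es j x).
  apply: seq_argmin; apply: contra L'0 => /eqP L'0.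
  by rewrite -cardfs_eq0 L'0.
pose t := modulus (es i0 x); have t0 : 0 <= t by exact: modulus_ge0.
have i0L : i0 \in L by move: i0L'; rewrite inE => /andP[].
have le_t j : j \notin L -> modulus (es j x) <= t by exact: greL.
have yE j : es j y = if j \in A then 0 else es j x by exact: coord_sub_proj.
have yL' i : i \in L' -> es i y = es i x.
  by rewrite inE yE => /andP[/negbTE ->].
have y_le_t j : j \notin L' -> modulus (es j y) <= t.
  rewrite inE negb_and negbK yE; case: ifP => /= _; first by rewrite modulus0.
  exact: le_t.
pose r := #|` L'|; have r0 : (0 < r)%N by rewrite cardfs_gt0.
have A'r : #|` A'| = r by rewrite /r !cardfsD fsetIC Lm Am.
have [NA ltNA] := seq_nat_bound A.
have [Gs [sGs FGs covGs]] := cov NA.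
have [N1 farN1] := far_proj_le p0 biorth b0 e_le es_le dens y r.
have [N2 ltN2] := seq_nat_bound (L' ++ flatten [seq enum_fset G | G <- Gs]).
have [E [FE Er NE]] := far r (maxn N1 N2) r0.
have notE n : n \in L' ++ flatten [seq enum_fset G | G <- Gs] -> n \notin E.
  move=> /ltN2 nN; apply/negP => /NE; rewrite geq_max => /andP[_].
  by rewrite leqNgt nN.
have dEL' : [disjoint E & L']%fset.
  rewrite fdisjoint_sym; apply/fdisjointP => n nL'.
  by apply: notE; rewrite mem_cat nL'.
have dEG G : G \in Gs -> [disjoint E & G]%fset.
  move=> GGs; rewrite fdisjoint_sym; apply/fdisjointP => n nG.
  apply: notE; rewrite mem_cat; apply/orP; right.
  by apply/flattenP; exists (enum_fset G) => //; apply: map_f.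
have yPE : ppow (y - P E y) <= 2 * ppow y.
  apply: (le_trans (ppowB _ _)); rewrite mulr_natl mulr2n lerD2l.
  by apply: farN1; rewrite ?Er // => n /NE; rewrite geq_max => /andP[].
have flatE : ppow (comb e E (fun=> real_scalar F t)) <= 2 * d * 2 * ppow y.
  have h : ppow (comb e E (fun=> real_scalar F t)) <= 2 * d * ppow (y - P E y).
    apply: (flat_le_greedy Fam0 fag FE _ dEL') => //.
    - by rewrite Er.
    - by move=> i iL'; rewrite yL' // i0min.
  apply: (le_trans h); by rewrite -[leRHS]mulrA ler_wpM2l ?mulr_ge0.
have tb : (t * b) `^ p <= (b * b) `^ p * ppow y.
  rewrite /ppow -powRM ?pnorm_ge0 ?mulr_ge0 ?(ltW b0) //.
  rewrite ge0_ler_powR ?nnegrE ?mulr_ge0 ?pnorm_ge0 ?(ltW b0) ?(ltW p0) //.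
  rewrite mulrAC ler_wpM2r ?(ltW b0) // /t -yL' //; exact: es_le.
have A'le : ppow (P A' x) <= (n0 + K0)%:R * (c1 * ppow y).
  (* singletons below n0 complete the cover *)
  pose Gs' := [seq [fset n]%fset | n <- iota 0 n0] ++ Gs.
  have : ppow (P A' x) <= (size Gs')%:R * (c1 * ppow y).
    apply: ppow_proj_cover => [n|G B].
      rewrite inE => /andP[nL /ltNA nNA]; rewrite has_cat.
      have [nn0|n0n] := ltnP n n0; last by rewrite covGs ?n0n ?orbT.
      apply/orP; left; apply/hasP; exists [fset n]%fset; last by rewrite inE.
      by apply: map_f; rewrite mem_iota.
    have Bt : (B `<=` A')%fset -> forall n, n \in B -> modulus (es n x) <= t.
      move=> /fsubsetP BA' n /BA'; rewrite inE => /andP[nL _]; exact: le_t.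
    rewrite mem_cat => /orP[/mapP[n _ ->]|GGs] BG BA'.
      apply: (@le_trans _ _ ((t * b) `^ p)); last first.
        rewrite (le_trans tb) // ler_wpM2r ?ppow_ge0 // lerDl.
        by rewrite !mulr_ge0.
      apply: (le_trans (ppow_comb p0 b0 e_le (Bt BA'))).
      rewrite ler_piMl ?powR_ge0 // lern1.
      by rewrite (leq_trans (fsubset_leq_card BG)) ?cardfs1.
    apply: (@le_trans _ _ (d * (2 * d * 2 * ppow y))); last first.
      by rewrite mulrA ler_wpM2r ?ppow_ge0 // lerDr powR_ge0.
    apply: le_trans (ler_wpM2l d0 flatE).
    apply: (proj_le_flat fag (FGs _ GGs) BG (dEG _ GGs)) => //.
    - by rewrite Er.
    - by rewrite Er -A'r fsubset_leq_card.
    - exact: Bt.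
  move=> /le_trans; apply; rewrite ler_wpM2r ?mulr_ge0 ?ppow_ge0 //.
  by rewrite ler_nat size_cat size_map size_iota leq_add2l.
have yL'le : ppow (y - P L' y) <= d * ppow y.
  rewrite [X in d * ppow X](_ : y = y - P fset0 y); last first.
    by rewrite coord_projE comb0 subr0.
  apply: fag => //; rewrite ?cardfs0 ?cardfs_gt0 //.
  split=> // i j iL' /y_le_t /le_trans; apply.
  by rewrite yL' // i0min.
have -> : x - P L x = (y - P L' y) + P A' x.
  have -> : P L' y = P L' x.
    rewrite eq_proj_sub //; apply/fdisjointP => n nA.
    by rewrite inE nA.
  rewrite /y !coord_projE (combID _ A L) (combID _ L A) fsetIC.
  by rewrite -/A' -/L' !opprD !addrA [RHS]addrAC subrK.
rewrite (le_trans (ppowD _ _)) // /c mulrDl lerD //.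
by rewrite -mulrA.
Qed.

End GreedyProperties.

(** * Translates of initial segments of the partial sums *)

Section GapFamily.
Variables (a : nat -> nat) (a_pos : forall n, (0 < a n)%N).

Definition psum i := (\sum_(j < i.+1) a j)%N.

Definition gap_set k l : {fset nat} :=
  [fset (k + psum i).-1%N | i in iota 0 l]%fset.

Lemma gap_setP k l n :
  reflect (exists2 i, (i < l)%N & n = (k + psum i).-1) (n \in gap_set k l).
Proof.
apply: (iffP (imfsetP _ _ _ _)) => /= -[i il ->]; exists i => //.
  by move: il; rewrite mem_iota.
by rewrite mem_iota.
Qed.

Lemma gap_set_family k l : (0 < l)%N -> gap_family a (gap_set k l).
Proof. by move=> l0; right; exists k, l. Qed.

Lemma psumS i : psum i.+1 = (psum i + a i.+1)%N.
Proof. by rewrite /psum big_ord_recr. Qed.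

Lemma psum_gt i : (i < psum i)%N.
Proof.
elim: i => [|i IH]; first by rewrite /psum big_ord_recr /= ltn_addl.
by rewrite psumS; have := a_pos i.+1; lia.
Qed.

Lemma psum_homo : {homo (fun i => psum i) : i j / (i < j)%N}.
Proof.
apply: homo_ltn => [|i]; first exact: ltn_trans.
by rewrite psumS -[ltnLHS]addn0 ltn_add2l.
Qed.

Lemma psum_leq i j : (i <= j)%N -> (psum i <= psum j)%N.
Proof. by rewrite leq_eqVlt => /predU1P[->//|/psum_homo/ltnW]. Qed.

Lemma card_gap_set k l : #|` gap_set k l| = l.
Proof.
have inj : injective (fun i => (k + psum i).-1%N).
  move=> i j ij; have := psum_gt i; have := psum_gt j; move: ij.
  by have [/psum_homo|/psum_homo|//] := ltngtP i j; lia.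
rewrite card_imfset; last exact: inj.
by rewrite /= undup_id ?iota_uniq // size_iota.
Qed.

Lemma gap_set_ge k l n : n \in gap_set k l -> (k <= n)%N.
Proof. by move=> /gap_setP[i _ ->]; have := psum_gt i; lia. Qed.

(** With gaps at most M, the distance from a point to the largest partial sum
    below it is less than M; this distance is the translation to use. *)
Lemma gap_set_cover M : (forall n, (a n <= M)%N) -> forall N n,
  (a 0 <= n < N)%N -> exists2 k, (k < M)%N & n \in gap_set k N.
Proof.
move=> aM N n /andP[a0n nN].
have ex0 : exists i, (psum i <= n.+1)%N.
  by exists 0%N; rewrite /psum big_ord_recr big_ord0 /= add0n leqW.
have ub i : (psum i <= n.+1)%N -> (i <= n)%N.
  by rewrite -ltnS; exact: leq_trans (psum_gt i).
have [i si imax] := ex_maxnP ex0 ub.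
have lt_si : (n.+1 < psum i.+1)%N.
  by rewrite ltnNge; apply/negP => /imax; rewrite ltnn.
exists (n.+1 - psum i)%N.
  by move: lt_si (aM i.+1); rewrite psumS; lia.
by apply/gap_setP; exists i; [exact: leq_ltn_trans (ub _ si) nN|lia].
Qed.

(** The points of D are chosen one after the other.  After c, the next point c'
    is put near the right end of a gap longer than c, so that c' + 1 - k is not
    a partial sum for any translation k <= c.  A translate of S that contains c
    is a translation by some k <= c, so it cannot contain c'. *)
Lemma sparse_for_gap_family : (forall M, exists n, (M < a n)%N) ->
  exists D : pred nat, [/\ forall N, exists2 n, (N <= n)%N & D n,
    forall N, exists2 n, (N <= n)%N & ~~ D n &
    forall G, gap_family a G -> forall m n, m \in G -> n \in G ->
      D m -> D n -> m = n].
Proof.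
move=> unb.
have step c : {c' | (c + 2 <= c')%N &
    forall i, ~~ (c'.+1 - c <= psum i <= c'.+1)%N}.
  apply: cid2; have [n] := unb (c + 2 + a 0%N)%N; case: n => [|n]; first by lia.
  (* psum n.+1 - 1 is the last integer of the gap between psum n and
     psum n.+1, and indices are shifted by one *)
  move=> an; exists (psum n.+1 - 2)%N.
    by rewrite psumS; have := psum_gt n; lia.
  move=> i; apply/negP => /andP[].
  have [ni|] := ltnP n i.
    by have := psum_leq ni; have := psum_gt n.+1; lia.
  by move=> /psum_leq; rewrite psumS; lia.
pose f n := iter n (fun c => projT1 (step c)) 0%N.
have fS n : (f n + 2 <= f n.+1)%N by rewrite /f /=; case: (step _) => c' [].
have f_avoid n i : ~~ ((f n.+1).+1 - f n <= psum i <= (f n.+1).+1)%N.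
  by rewrite /f /=; case: (step _) => c' [].
have f_lt : {homo f : m n / (m < n)%N}.
  by apply: homo_ltn => [|n]; [exact: ltn_trans|have := fS n; lia].
have f_ge n : (n <= f n)%N by elim: n => // n IH; have := fS n; lia.
have f_le m n : (m <= n)%N -> (f m <= f n)%N.
  by rewrite leq_eqVlt => /predU1P[->//|/f_lt/ltnW].
pose D : pred nat := fun n => `[< exists i, n = f i >].
exists D; split.
- by move=> N; exists (f N) => //; apply/asboolP; exists N.
- move=> N; exists (f N).+1; first exact: leqW.
  apply/asboolPn => -[j jE]; move: jE; have [/f_le|/f_le] := leqP j N; first by lia.
  by have := fS N => ?; lia.
move=> G + m n mG nG /asboolP[i mi] /asboolP[j nj].
(* both points lie in k + S; when f u < f v, the value f v + 1 - k would be a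
   partial sum in the window that f v was chosen to avoid *)
have main k l u v : f u \in gap_set k l -> f v \in gap_set k l -> ~ (u < v)%N.
  case: v => [//|v] /gap_setP[i1 _ e1] /gap_setP[i2 _ e2]; rewrite ltnS => uv.
  have := f_avoid v i2; have := f_le _ _ uv; have := psum_gt i1.
  by move: e1 e2; have := psum_gt i2; have := f_lt _ _ (ltnSn v); lia.
case=> [G0|[k [l [_ Gkl]]]]; first by move: mG; rewrite G0 inE.
move: mG nG; rewrite mi nj Gkl => mG nG.
have [ij|ji|-> //] := ltngtP i j.
  by case: (main k l i j).
by case: (main k l j i).
Qed.

End GapFamily.

(** * Spaces normed by sums over test sets *)

Section ScalarCompleteness.
Variables (R : realType).

Lemma real_cauchy_limit (u : nat -> R) :
  (forall eps : R, 0 < eps -> exists N, forall m n, (N <= m)%N -> (N <= n)%N ->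
     `|u m - u n| < eps) ->
  exists l, forall eps : R, 0 < eps -> exists N, forall n, (N <= n)%N ->
     `|u n - l| < eps.
Proof.
move=> uC; have /R_complete ucv : cauchy (u @ \oo).
  apply: cauchy_exP => eps eps0; have [N uN] := uC _ eps0.
  exists (u N); rewrite -ball_normE; exists N => // n /= Nn; exact: uN.
exists (lim (u @ \oo)) => eps eps0.
have /cvgrPdist_lt/(_ _ eps0)[N _ uN] := ucv.
by exists N => n /uN; rewrite distrC.
Qed.

Lemma modulus_le_ReIm (w : R[i]) :
  @modulus R ComplexScalars w <= `|complex.Re w| + `|complex.Im w|.
Proof.
rewrite /modulus normc_def /= -[leRHS]ger0_norm ?addr_ge0 //.
rewrite -sqrtr_sqr; apply: ler_wsqrtr; rewrite sqrrD !real_normK ?num_real //.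
by rewrite addrAC lerDl mulrn_wge0 // mulr_ge0.
Qed.

Lemma scalar_cauchy_limit (F : scalar_kind) (z : nat -> scalars R F) :
  (forall eps : R, 0 < eps -> exists N, forall m n, (N <= m)%N -> (N <= n)%N ->
     modulus (z m - z n) < eps) ->
  exists l, forall eps : R, 0 < eps -> exists N, forall n, (N <= n)%N ->
     modulus (z n - l) < eps.
Proof.
case: F z => z; first exact: real_cauchy_limit.
have leRe (w : R[i]) : `|complex.Re w| <= @modulus R ComplexScalars w.
  rewrite /modulus normc_def /= -sqrtr_sqr; apply: ler_wsqrtr.
  by rewrite lerDl sqr_ge0.
have leIm (w : R[i]) : `|complex.Im w| <= @modulus R ComplexScalars w.
  rewrite /modulus normc_def /= -sqrtr_sqr; apply: ler_wsqrtr.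
  by rewrite lerDr sqr_ge0.
move=> zC.
have [|u uP] := @real_cauchy_limit (fun n => complex.Re (z n)).
  move=> eps /zC[N zN]; exists N => m n Nm Nn.
  apply: le_lt_trans (zN _ _ Nm Nn); apply: le_trans (leRe _).
  by case: (z m) (z n) => ? ? [].
have [|v vP] := @real_cauchy_limit (fun n => complex.Im (z n)).
  move=> eps /zC[N zN]; exists N => m n Nm Nn.
  apply: le_lt_trans (zN _ _ Nm Nn); apply: le_trans (leIm _).
  by case: (z m) (z n) => ? ? [].
exists (u +i* v)%C => eps eps0.
have e2 : 0 < eps / 2 by rewrite divr_gt0.
have [N uN] := uP _ e2; have [M vM] := vP _ e2.
exists (maxn N M) => n; rewrite geq_max => /andP[/uN un /vM vn].
apply: (le_lt_trans (modulus_le_ReIm _)); rewrite (splitr eps).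
by move: un vn; case: (z n) => ? ? /= un vn; exact: ltrD.
Qed.

End ScalarCompleteness.

Section TestSpace.
Variables (R : realType) (F : scalar_kind) (test : set {fset nat}).
Local Notation K := (scalars R F).

Definition test_sum (A : {fset nat}) (N : nat) (x : nat -> K^o) : R :=
  \sum_(i <- A | (N <= i)%N) modulus (x i).

(** This c_0-type condition makes the finitely supported sequences dense, which
    finiteness of the norm alone does not ensure. *)
Definition small_tails (x : nat -> K^o) : Prop :=
  forall eps : R, 0 < eps -> exists N, forall A, test A -> test_sum A N x <= eps.

Definition test_space_pred : {pred (nat -> K^o)} := fun x => `[< small_tails x >].

Lemma test_sumD A N x y :
  test_sum A N (x + y) <= test_sum A N x + test_sum A N y.
Proof.
by rewrite /test_sum -big_split; apply: ler_sum => i _; exact: modulusD.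
Qed.

Lemma test_sumZ A N (c : K) x :
  test_sum A N (c *: x) = modulus c * test_sum A N x.
Proof. by rewrite mulr_sumr; apply: eq_bigr => i _; exact: modulusM. Qed.

Lemma test_sum_ge0 A N x : 0 <= test_sum A N x.
Proof. by apply: sumr_ge0 => i _; exact: modulus_ge0. Qed.

Lemma test_sum_leq A M N x : (M <= N)%N -> test_sum A N x <= test_sum A M x.
Proof.
move=> MN; rewrite /test_sum big_mkcond [leRHS]big_mkcond.
apply: ler_sum => i _; case: ifP => [/(leq_trans MN) -> //|_].
by case: ifP => // _; exact: modulus_ge0.
Qed.

Lemma test_space_submod : submod_closed test_space_pred.
Proof.
split=> [|c x y /asboolP xs /asboolP ys].
  apply/asboolP => eps eps0; exists 0%N => A _.
  by rewrite /test_sum big1 ?ltW // => i _; exact: modulus0.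
apply/asboolP => eps eps0.
have c0 : 0 < 2 * (modulus c + 1) by rewrite mulr_gt0 // ltr_wpDl ?modulus_ge0.
have [N xN] := xs _ (divr_gt0 eps0 c0).
have [M yM] := ys _ (divr_gt0 eps0 (ltr0Sn R 1)).
exists (maxn N M) => A tA; apply: (le_trans (test_sumD _ _ _ _)).
rewrite test_sumZ (splitr eps) lerD //; last first.
  exact: le_trans (test_sum_leq _ _ (leq_maxr _ _)) (yM _ tA).
have c1 : modulus c + 1 != 0 by rewrite gt_eqF // ltr_wpDl ?modulus_ge0.
apply: (@le_trans _ _ ((modulus c + 1) * (eps / (2 * (modulus c + 1))))).
  apply: ler_pM; rewrite ?modulus_ge0 ?test_sum_ge0 ?lerDl //.
  exact: le_trans (test_sum_leq _ _ (leq_maxl _ _)) (xN _ tA).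
by rewrite invfM mulrCA [2^-1 * _]mulrC mulVKf.
Qed.

HB.instance Definition _ :=
  GRing.isSubmodClosed.Build K (nat -> K^o) test_space_pred test_space_submod.

Record test_space := TestSpace {
  test_fun :> nat -> K^o; _ : test_fun \in test_space_pred }.

HB.instance Definition _ := [isSub for test_fun].
HB.instance Definition _ := [Choice of test_space by <:].
HB.instance Definition _ := [SubChoice_isSubLmodule of test_space by <:].

End TestSpace.

Lemma ler_sum_subset (R : realType) (I : eqType) (s s' : seq I) (f : I -> R) :
  uniq s -> uniq s' -> {subset s <= s'} -> (forall i, 0 <= f i) ->
  \sum_(i <- s) f i <= \sum_(i <- s') f i.
Proof.
move=> us us' ss' f0.
have -> : \sum_(i <- s) f i = \sum_(i <- s' | i \in s) f i.
  rewrite -[RHS]big_filter; apply: perm_big; apply: uniq_perm => //.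
    exact: filter_uniq.
  by move=> i; rewrite mem_filter; case: (boolP (i \in s)) => // /ss' ->.
by rewrite [leRHS](bigID (mem s)) /= lerDl sumr_ge0.
Qed.

Section TestSpaceNorm.
Variables (R : realType) (F : scalar_kind) (test : set {fset nat}).
Hypothesis test1 : forall n, test [fset n]%fset.
Local Notation K := (scalars R F).
Local Notation X := (test_space R F test).
Implicit Types (x y : X) (A : {fset nat}).

Lemma test_space_tails x : small_tails test x.
Proof. by case: x => x /= /asboolP. Qed.

(** Test sums are uniformly bounded once the tails are. *)
Lemma test_sum_split A N (x : nat -> K^o) :
  test_sum A 0 x <= \sum_(i < N) modulus (x i) + test_sum A N x.
Proof.
rewrite /test_sum (bigID (fun i => (N <= i)%N)) /= addrC lerD //.
rewrite -(big_mkord xpredT (fun i => modulus (x i))) -big_filter.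
apply: ler_sum_subset => [|||i]; last exact: modulus_ge0.
- by rewrite filter_uniq ?fset_uniq.
- exact: iota_uniq.
- by move=> i; rewrite mem_filter mem_index_iota -ltnNge => /andP[].
Qed.

Definition test_norm x : R := sup [set test_sum A 0 x | A in test].

Lemma test_sum_norm x A : test A -> test_sum A 0 x <= test_norm x.
Proof.
move=> tA; apply: ub_le_sup; last by exists A.
have [N xN] := test_space_tails x ltr01.
exists (\sum_(i < N) modulus (x i) + 1) => _ [B tB <-].
by rewrite (le_trans (test_sum_split _ N _)) // lerD2l xN.
Qed.

Lemma test_norm_le x c :
  (forall A, test A -> test_sum A 0 x <= c) -> test_norm x <= c.
Proof.
move=> xc; apply: ge_sup; first by exists (test_sum [fset 0%N]%fset 0 x), [fset 0%N]%fset.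
by move=> _ [A tA <-]; exact: xc.
Qed.

Lemma coord_le_norm x n : modulus (x n) <= test_norm x.
Proof.
by apply: le_trans (test_sum_norm _ (test1 n)); rewrite /test_sum big_seq_fset1.
Qed.

Lemma test_norm_ge0 x : 0 <= test_norm x.
Proof. exact: le_trans (modulus_ge0 _) (coord_le_norm x 0). Qed.

Lemma test_norm_eq0 x : test_norm x = 0 -> x = 0.
Proof.
move=> x0; apply: val_inj; apply/funext => n; apply: modulus0_eq0.
by apply/le_anti; rewrite modulus_ge0 -x0 coord_le_norm.
Qed.

Lemma test_normZ_le (c : K) x : test_norm (c *: x) <= modulus c * test_norm x.
Proof.
apply: test_norm_le => A tA.
by rewrite test_sumZ ler_wpM2l ?modulus_ge0 ?test_sum_norm.
Qed.

Lemma test_normZ (c : K) x : test_norm (c *: x) = modulus c * test_norm x.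
Proof.
apply/le_anti; rewrite test_normZ_le /=.
have [->|c0] := eqVneq c 0; first by rewrite modulus0 mul0r test_norm_ge0.
rewrite -[x in leLHS](scalerK c0) -ler_pdivlMl ?modulus_gt0 // -modulusV.
exact: test_normZ_le.
Qed.

Lemma test_normD x y : test_norm (x + y) <= test_norm x + test_norm y.
Proof.
apply: test_norm_le => A tA; apply: (le_trans (test_sumD _ _ _ _)).
by rewrite lerD ?test_sum_norm.
Qed.

Lemma test_normDp x y :
  test_norm (x + y) `^ 1 <= test_norm x `^ 1 + test_norm y `^ 1.
Proof. by rewrite !powRr1 ?test_norm_ge0 // test_normD. Qed.

(** The norm is a supremum of seminorms involving finitely many coordinates
    each, so the coordinatewise limit of a Cauchy sequence is its limit in
    norm; smallness of tails then passes to the limit. *)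
Lemma test_norm_complete (u : nat -> X) :
  (forall eps : R, 0 < eps -> \forall m & n \near \oo,
     test_norm (u m - u n) < eps) ->
  exists l : X, (fun n => test_norm (u n - l)) @ \oo --> (0 : R).
Proof.
move=> uC.
have uC' (eps : R) : 0 < eps -> exists N, forall m n, (N <= m)%N -> (N <= n)%N ->
    test_norm (u m - u n) < eps.
  move=> /uC[[P Q] /= [[N _ NP] [M _ MQ]] PQ].
  exists (maxn N M) => m n; rewrite !geq_max => /andP[mN _] /andP[_ nM].
  by apply: (PQ (m, n)); split; [exact: NP|exact: MQ].
have /choice[l lP] : forall i, exists li : K, forall eps : R, 0 < eps ->
    exists N, forall n, (N <= n)%N -> modulus (u n i - li) < eps.
  move=> i; apply: scalar_cauchy_limit => eps /uC'[N uN]; exists N => m n Nm Nn.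
  apply: le_lt_trans (uN _ _ Nm Nn); exact: (coord_le_norm (u m - u n)).
have sumP (s : seq nat) (eps : R) : 0 < eps -> exists N, forall n, (N <= n)%N ->
    \sum_(i <- s) modulus (u n i - l i) < eps.
  elim: s eps => [|i s IH] eps eps0; first by exists 0%N => n _; rewrite big_nil.
  have e2 : 0 < eps / 2 by rewrite divr_gt0.
  have [N sN] := IH _ e2; have [M iM] := lP i _ e2.
  exists (maxn N M) => n; rewrite geq_max => /andP[/sN sn /iM lin].
  by rewrite big_cons (splitr eps) ltrD.
have close (eps : R) : 0 < eps -> exists N, forall m A, (N <= m)%N -> test A ->
    test_sum A 0 ((u m : nat -> K^o) - l) <= eps.
  move=> /uC'[N uN]; exists N => m A Nm tA; apply/ler_addgt0Pr => d d0.
  have [M sM] := sumP A _ d0; pose n := maxn N M.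
  have -> : (u m : nat -> K^o) - l =
      ((u m - u n : X) : nat -> K^o) + ((u n : nat -> K^o) - l).
    by apply/funext => i; rewrite /= !fctE /= addrA subrK.
  apply: (le_trans (test_sumD _ _ _ _)); rewrite lerD //.
    by apply: (le_trans (test_sum_norm _ tA)); rewrite ltW // uN // leq_maxl.
  by rewrite /test_sum /= ltW // sM // leq_maxr.
have lsmall : (l : nat -> K^o) \in @test_space_pred R F test.
  apply/asboolP => eps eps0; have e2 : 0 < eps / 2 by rewrite divr_gt0.
  have [m mP] := close _ e2; have [N uN] := test_space_tails (u m) e2.
  exists N => A tA.
  have -> : (l : nat -> K^o) = (u m : nat -> K^o) + (-1 : K) *: ((u m : nat -> K^o) - l).
    by apply/funext => i; rewrite !fctE scaleN1r opprB addrC subrK.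
  apply: (le_trans (test_sumD _ _ _ _)); rewrite (splitr eps) lerD ?uN //.
  rewrite test_sumZ modulusN modulus1 mul1r.
  exact: le_trans (test_sum_leq _ _ (leq0n N)) (mP _ _ (leqnn m) tA).
exists (TestSpace lsmall); apply/cvgrPdist_le => eps eps0.
have [N NP] := close _ eps0; exists N => // n /= Nn.
rewrite sub0r normrN ger0_norm ?test_norm_ge0 //.
by apply: test_norm_le => A tA; exact: NP.
Qed.

Definition test_banach : pBanachSpace F (1 : R) :=
  PBanachSpace test_norm_ge0 test_norm_eq0 test_normZ test_normDp
    test_norm_complete.

End TestSpaceNorm.

(** * The unit vectors of a test space *)

Lemma real_approx (R : realType) (z eps : R) : 0 < eps ->
  exists r : rat, `|z - ratr r| < eps.
Proof.
move=> eps0; have [|r] := @rat_in_itvoo R (z - eps) (z + eps).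
  by rewrite ltrBlDr -addrA ltrDl addr_gt0.
rewrite in_itv /= => /andP[r1 r2]; exists r.
by rewrite ltr_norml ltrBrDl ltrBlDr addrC -ltrBlDr; apply/andP; split; lra.
Qed.

Definition rat_scalar (R : realType) (F : scalar_kind) (r : rat * rat) :
    scalars R F :=
  match F return scalars R F with
  | RealScalars => ratr r.1
  | ComplexScalars => (ratr r.1 +i* ratr r.2)%C
  end.

Lemma scalar_approx (R : realType) (F : scalar_kind) (z : scalars R F)
    (eps : R) : 0 < eps ->
  exists r, modulus (z - rat_scalar R F r) < eps.
Proof.
case: F z => [z|[u v]] eps0.
  by have [r zr] := real_approx z eps0; exists (r, 0).
have e2 : 0 < eps / 2 by rewrite divr_gt0.
have [r ur] := real_approx u e2; have [s vs] := real_approx v e2.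
exists (r, s); apply: (le_lt_trans (modulus_le_ReIm _)).
by rewrite (splitr eps) ltrD.
Qed.

Section TestSpaceBasis.
Variables (R : realType) (F : scalar_kind) (test : set {fset nat}).
Hypothesis test1 : forall n, test [fset n]%fset.
Local Notation K := (scalars R F).
Local Notation X := (test_banach R F test1).
Implicit Types (x y : X).

Lemma unit_small_tails n :
  (fun i => (i == n)%:R : K^o) \in @test_space_pred R F test.
Proof.
apply/asboolP => eps eps0; exists n.+1 => A _.
rewrite /test_sum big1 ?ltW // => i ni.
by rewrite gtn_eqF // modulus0.
Qed.

Definition unit_vector n : X := TestSpace (unit_small_tails n).

Definition coord n : X -> K := fun x => (x : test_space R F test) n.

Lemma coord_is_linear n : scalar (coord n).
Proof. by []. Qed.

HB.instance Definition _ n :=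
  GRing.isLinear.Build K X K *%R (coord n) (coord_is_linear n).

Definition coords n : {scalar X} := coord n.

Lemma coords_unit m n : coords m (unit_vector n) = (m == n)%:R.
Proof. by []. Qed.

Lemma coordsZ_unit m n (c : K) : coords m (c *: unit_vector n) = c * (m == n)%:R.
Proof. by []. Qed.

Lemma coord_le x n : modulus (coords n x) <= pnorm x.
Proof. exact: coord_le_norm. Qed.

Lemma pnorm_unit n : pnorm (unit_vector n) = 1.
Proof.
apply/le_anti/andP; split; last first.
  by have := coord_le (unit_vector n) n; rewrite coords_unit eqxx modulus1.
apply: (test_norm_le test1) => A tA; rewrite /test_sum /=.
have [nA|nA] := boolP (n \in A).
  rewrite (big_fsetD1 n) //= eqxx modulus1 big1_fset ?addr0 // => i.
  by rewrite !inE => /andP[/negbTE -> _] _; rewrite modulus0.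
rewrite big1_fset ?ler01 // => i iA _.
by have [ein|] := eqVneq i n; [rewrite -ein iA in nA|rewrite modulus0].
Qed.

Lemma coord_lin_comb N (c : nat -> K) j :
  coords j (\sum_(i < N) c i *: unit_vector i) = if (j < N)%N then c j else 0.
Proof.
rewrite linear_sum; under eq_bigr do rewrite coordsZ_unit.
case: ltnP => jN.
  rewrite (bigD1 (Ordinal jN)) //= eqxx mulr1 big1 ?addr0 // => i.
  by rewrite -val_eqE /= eq_sym => /negbTE ->; rewrite mulr0.
by rewrite big1 // => i _; rewrite gtn_eqF ?mulr0 // (leq_trans _ jN).
Qed.

Lemma unit_vectors_dense : pdense (linear_span unit_vector).
Proof.
move=> x eps eps0; have e2 : 0 < eps / 2 by rewrite divr_gt0.
have [N xN] := test_space_tails (x : test_space R F test) e2.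
exists (\sum_(i < N) coords i x *: unit_vector i).
  by exists N, (fun i => coords i x).
apply: (@le_lt_trans _ _ (eps / 2)); last by lra.
set y := \sum_(_ < _) _.
apply: (test_norm_le test1) => A /xN; apply: le_trans.
rewrite /test_sum [leRHS]big_mkcond; apply: ler_sum => i _.
have -> : ((x - y : X) : test_space R F test) i = coords i x - coords i y by [].
by rewrite coord_lin_comb; case: ltnP => _; rewrite ?subrr ?modulus0 ?subr0.
Qed.

Lemma coords_in_dual n : in_dual (coords n).
Proof.
move=> x eps eps0; exists eps => // y; rewrite -linearB; apply: le_lt_trans.
exact: coord_le.
Qed.

(** A functional that is continuous is determined by its values on the dense
    span of the unit vectors, whence the uniqueness of the dual system; the
    norms of the unit vectors and of the coordinate functionals are all 1. *)
Lemma unit_basis : is_basis unit_vector coords.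
Proof.
split.
- exact: unit_vectors_dense.
- by split; [exact: coords_in_dual|].
- move=> fs [fsc fsb] n x; apply/eqP; rewrite -subr_eq0; apply/eqP.
  apply: modulus0_eq0; apply/le_anti; rewrite modulus_ge0 andbT.
  apply/ler_addgt0Pr => eps eps0; rewrite add0r.
  have e2 : 0 < eps / 2 by rewrite divr_gt0.
  have [d d0 fd] := fsc n x _ e2; have [d' d'0 fd'] := coords_in_dual n x e2.
  have dd : 0 < Num.min d d' by rewrite lt_min d0.
  have [_ [N [c ->]]] := unit_vectors_dense x dd.
  set y := \sum_(_ < _) _; rewrite lt_min -(pnormN (x - y)) opprB => /andP[yd yd'].
  have fy : fs n y = coords n y.
    rewrite !linear_sum; apply: eq_bigr => i _.
    by rewrite coordsZ_unit linearZ /= fsb.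
  have -> : fs n x - coords n x = - (fs n y - fs n x) + (coords n y - coords n x).
    by rewrite fy opprB addrA subrK.
  rewrite ltW // (le_lt_trans (modulusD _ _)) // modulusN (splitr eps).
  by rewrite ltrD ?fd ?fd'.
- apply: (@lt_le_trans _ _ 1%E); first exact: lte01.
  apply: le_ereal_inf_tmp => _ [[n _ <-]|[n _ <-]]; rewrite ?pnorm_unit //.
  apply: ereal_sup_ubound; exists (unit_vector n).
    by rewrite /mkset pnorm_unit.
  by rewrite coords_unit eqxx modulus1.
- apply: (@le_lt_trans _ _ 1%E); last exact: ltry.
  apply: ge_ereal_sup => _ [[n _ <-]|[n _ <-]]; rewrite ?pnorm_unit //.
  apply: ge_ereal_sup => _ [x /= x1 <-]; rewrite lee_fin.
  exact: le_trans (coord_le _ _) x1.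
Qed.

Lemma test_banach_separable : separable_space X.
Proof.
pose v (s : seq (rat * rat)) : X :=
  \sum_(i < size s) rat_scalar R F (nth (0, 0) s i) *: unit_vector i.
exists (range v); split; first exact: card_le_trans (card_image_le _ _) (countableP _).
move=> x eps eps0; have e2 : 0 < eps / 2 by rewrite divr_gt0.
have [_ [N [c ->]] xy] := unit_vectors_dense x e2.
have eN : 0 < eps / 2 / N.+1%:R by rewrite divr_gt0.
have /choice[q qP] : forall i, exists r,
    modulus (c i - rat_scalar R F r) < eps / 2 / N.+1%:R.
  by move=> i; exact: scalar_approx.
exists (v (mkseq q N)); first by exists (mkseq q N).
set y := \sum_(_ < _) _ in xy.
have -> : v (mkseq q N) = \sum_(i < N) rat_scalar R F (q i) *: unit_vector i.
  rewrite /v size_mkseq; apply: eq_bigr => i _; by rewrite nth_mkseq.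
set w := \sum_(_ < _) _.
have -> : x - w = (x - y) + (y - w) by rewrite addrA subrK.
apply: (le_lt_trans (test_normD test1 _ _)); rewrite (splitr eps) ltr_leD //.
have yw : pnorm (y - w) <= \sum_(i < N) (eps / 2 / N.+1%:R).
  rewrite /y /w -sumrB.
  elim/big_ind2 : _ => [|r s z t rs zt|i _]; first by rewrite pnorm0.
    exact: le_trans (test_normD test1 _ _) (lerD rs zt).
  by rewrite -scalerBl pnormZ pnorm_unit mulr1 ltW.
apply: (le_trans yw); rewrite sumr_const card_ord -[leLHS]mulr_natr mulrAC.
by rewrite ler_pdivrMr // ler_wpM2l ?(ltW e2) // ler_nat.
Qed.

(** If n vectors spanned the space, the n + 1 first unit vectors would be the
    rows of a matrix with n columns applied to them; a nontrivial relation
    between these rows contradicts biorthogonality. *)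
Lemma unit_vectors_infinite_dimensional : infinite_dimensional X.
Proof.
move=> n v; apply: contrapT => /forallNP h.
have /choice[c cP] : forall k : 'I_n.+1, exists c : 'rV[K]_n,
    unit_vector k = \sum_i c 0 i *: v i.
  move=> k; have := h (unit_vector k); rewrite -existsNE => -[c /contrapT ->].
  by exists (\row_i c i); apply: eq_bigr => i _; rewrite mxE.
pose A : 'M[K]_(n.+1, n) := \matrix_(k, i) c k 0 i.
have [u u0 uA] : exists2 u : 'rV[K]_n.+1, u != 0 & u *m A = 0.
  have kA : kermx A != 0.
    by rewrite -mxrank_eq0 mxrank_ker subn_eq0 -ltnNge ltnS rank_leq_col.
  exists (nz_row (kermx A)); rewrite ?nz_row_eq0 //.
  by apply/sub_kermxP; exact: nz_row_sub.
have : \sum_k u 0 k *: unit_vector k = 0.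
  under eq_bigr do rewrite cP scaler_sumr.
  rewrite exchange_big big1 //= => i _.
  under eq_bigr do rewrite scalerA.
  rewrite -scaler_suml.
  have := congr1 (fun M : 'rV_n => M 0 i) uA; rewrite !mxE.
  by under eq_bigr do rewrite mxE; move=> ->; rewrite scale0r.
move=> s0; move/eqP: u0; apply; apply/rowP => k; rewrite mxE.
have := congr1 (coords k) s0; rewrite linear0 linear_sum (bigD1 k) //.
rewrite coordsZ_unit eqxx mulr1 big1 => [|j jk]; first by rewrite /= addr0.
by rewrite coordsZ_unit eq_sym (negbTE jk : (j == k :> nat) = false) mulr0.
Qed.

End TestSpaceBasis.

(** * A space that is l_1 on a sparse set and c_0 elsewhere *)

Lemma fset_of_card (P : pred nat) : (forall N, exists2 n, (N <= n)%N & P n) ->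
  forall m, exists2 A : {fset nat}, #|` A| = m & forall n, n \in A -> P n.
Proof.
move=> infP; elim=> [|m [A Am AP]]; first by exists fset0; rewrite ?cardfs0.
have [N NA] := seq_nat_bound A; have [n Nn Pn] := infP N.
have nA : n \notin A by apply/negP => /NA; rewrite ltnNge Nn.
exists (n |` A)%fset; first by rewrite cardfsU1 nA Am.
by move=> k; rewrite !inE => /predU1P[->|/AP].
Qed.

Section SparseSpace.
Variables (R : realType) (F : scalar_kind) (D : pred nat).
Local Notation K := (scalars R F).

(** The singletons account for the supremum norm, the subsets of D for the l_1
    norm on D. *)
Definition sparse_test : set {fset nat} :=
  [set A | (exists n, A = [fset n]%fset) \/ (forall n, n \in A -> D n)].

Lemma sparse_test1 n : sparse_test [fset n]%fset.
Proof. by left; exists n. Qed.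

Local Notation X := (test_banach R F sparse_test1).
Local Notation e := (unit_vector R F sparse_test1).
Local Notation es := (coords R F sparse_test1).

Let biorth m n : es m (e n) = (m == n)%:R := coords_unit R F sparse_test1 m n.

Lemma pnorm_sparse_le (x : X) (c : R) :
  (forall n, modulus (es n x) <= c) ->
  (forall A : {fset nat}, (forall n, n \in A -> D n) ->
     \sum_(n <- A) modulus (es n x) <= c) ->
  pnorm x <= c.
Proof.
move=> x1 xD; apply: (test_norm_le sparse_test1) => A [[n ->]|AD].
  by rewrite /test_sum big_seq_fset1; exact: x1.
exact: xD.
Qed.

Lemma sum_le_pnorm_sparse (x : X) (A : {fset nat}) :
  (forall n, n \in A -> D n) -> \sum_(n <- A) modulus (es n x) <= pnorm x.
Proof. by move=> AD; apply: test_sum_norm; right. Qed.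

(** Every coordinate left by the greedy set L is dominated by
    y = x - P_A x: a coordinate removed with A but not with L is at most, in
    modulus, one that L removes and A does not.  In a sum over a subset of D at most one
    coordinate has been removed with A, so the total is at most twice the norm
    of y. *)
Lemma sparse_family_almost_greedy (Fam : set {fset nat}) : Fam fset0 ->
  (forall G, Fam G -> forall m n, m \in G -> n \in G -> D m -> D n -> m = n) ->
  family_almost_greedy Fam e es.
Proof.
move=> Fam0 FamD; exists 2; first by rewrite ler1n.
move=> x m L m0 [Lm greL].
apply: le_inf_image => //; first by exists fset0; split.
move=> A [FA Am]; set y := x - coord_proj e es A x.
set z := x - coord_proj e es L x.
have zE j : es j z = if j \in L then 0 else es j x by exact: coord_sub_proj.
have yE j : es j y = if j \in A then 0 else es j x by exact: coord_sub_proj.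
have y0 : 0 <= pnorm y by exact: pnorm_ge0.
have z_le j : modulus (es j z) <= pnorm y.
  rewrite zE; case: ifPn => jL; first by rewrite modulus0.
  have [jA|jA] := boolP (j \in A); last first.
    by have := coord_le y j; rewrite yE (negbTE jA).
  have [i iL iA] : exists2 i, i \in L & i \notin A.
    have /fset0Pn[u] : (L `\` A)%fset != fset0.
      rewrite -cardfs_gt0 cardfsD subn_gt0 fsetIC.
      rewrite -Lm in Am; apply: leq_trans Am; apply: fproper_ltn_card.
      by rewrite fproperE fsubsetIl /=; apply/negP => /fsubsetP/(_ _ jA);
        rewrite inE (negbTE jL) andbF.
    by rewrite inE => /andP[uA uL]; exists u.
  apply: le_trans (greL _ _ iL jL) _.
  by have := coord_le y i; rewrite yE (negbTE iA).
apply: pnorm_sparse_le => [j|T TD].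
  by rewrite (le_trans (z_le j)) // ler_peMl // ler1n.
apply: (@le_trans _ _ (\sum_(n <- T) (modulus (es n y) +
    (if n \in A then pnorm y else 0)))).
  apply: ler_sum => n _; case: ifPn => nA.
    by rewrite (le_trans (z_le n)) // lerDr modulus_ge0.
  rewrite addr0 yE (negbTE nA) zE; case: ifP => // _.
  by rewrite modulus0 modulus_ge0.
rewrite big_split mulr_natl mulr2n lerD ?sum_le_pnorm_sparse //=.
have [/hasP[i iT iA]|/hasPn TA] := boolP (has (fun n => n \in A) T).
  rewrite (big_fsetD1 i) //= iA big1_fset ?addr0 // => j.
  rewrite !inE => /andP[/eqP ji jT] _; case: ifPn => // jA.
  by case: ji; apply: (FamD _ FA) => //; exact: TD.
by rewrite big_seq big1 // => i /TA /negbTE ->.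
Qed.

(** The witness is the flat vector on the union of m points of D and m points
    off D, all of whose coordinates may be removed in any order. *)
Lemma sparse_not_almost_greedy :
  (forall N, exists2 n, (N <= n)%N & D n) ->
  (forall N, exists2 n, (N <= n)%N & ~~ D n) ->
  ~ almost_greedy e es.
Proof.
move=> infD infD' [C C0 agC].
pose m := (Num.bound C).+1.
have Cm : C < m%:R.
  by rewrite (lt_trans (archi_boundP (ltW C0))) // ltr_nat.
have [A Am AD] := fset_of_card infD m; have [B Bm BD] := fset_of_card infD' m.
have dAB : [disjoint A & B]%fset.
  by apply/fdisjointP => n /AD Dn; apply/negP => /BD; rewrite Dn.
pose x : X := comb e (A `|` B)%fset (fun=> 1 : K).
have xE j : es j x = if j \in (A `|` B)%fset then 1 else 0.
  exact: coord_comb.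
have greB : greedy_set es x m B.
  split=> // i j iB jB; rewrite (xE i) inE iB orbT modulus1 xE.
  by case: ifP => _; rewrite ?modulus0 ?modulus1.
have xB : x - coord_proj e es B x = comb e A (fun=> 1 : K).
  rewrite coord_proj_comb ?fsubsetUr // combB ?fsubsetUr //.
  by rewrite fsetDUl fsetDv fsetU0; congr comb; apply/fsetDidPl.
have xA : x - coord_proj e es A x = comb e B (fun=> 1 : K).
  rewrite coord_proj_comb ?fsubsetUl // combB ?fsubsetUl //.
  rewrite fsetDUl fsetDv fset0U; congr comb; apply/fsetDidPl.
  by rewrite fdisjoint_sym.
have := agC x m B isT greB; apply/negP; rewrite -ltNge.
apply: (@le_lt_trans _ _ C).
  rewrite -[leRHS]mulr1 ler_wpM2l ?(ltW C0) //.
  apply: (@le_trans _ _ (pnorm (x - coord_proj e es A x))).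
    apply: (inf_image_le (f := fun A => pnorm (x - coord_proj e es A x))) => //.
    by move=> ?; exact: pnorm_ge0.
  rewrite xA; apply: pnorm_sparse_le => [n|T TD].
    by rewrite coord_comb //; case: ifP; rewrite ?modulus0 ?modulus1.
  rewrite big_seq big1 // => n /TD Dn; rewrite coord_comb //.
  by case: ifP => [/BD|_]; rewrite ?Dn ?modulus0.
apply: (lt_le_trans Cm); rewrite xB.
apply: le_trans (sum_le_pnorm_sparse _ AD).
rewrite big_seq (eq_bigr (fun=> 1)) => [|n nA].
  by rewrite -big_seq big_const_seq count_predT iter_addr_0 Am.
by rewrite coord_comb // nA modulus1.
Qed.

End SparseSpace.

Theorem theorem2p5 (R : realType) (F : scalar_kind) (a : nat -> nat)
    (a_pos : forall n : nat, (0 < a n)%N) :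
  (exists M : nat, forall n : nat, (a n <= M)%N) <->
  (forall p : R, 0 < p -> p <= 1 ->
   forall X : pBanachSpace F p, separable_space X -> infinite_dimensional X ->
   forall (e : nat -> X) (es : nat -> {scalar X}), is_basis e es ->
     (family_almost_greedy (gap_family a) e es <-> almost_greedy e es)).
Proof.
have gap0 : gap_family a fset0 by left.
split=> [[M aM] p p0 _ X _ _ e es bas | ag].
  split; last exact: almost_greedy_family.
  apply: (@covering_family_almost_greedy _ _ _ p0 _ _ _ bas _ (a 0%N) M) => //.
    move=> r N r0; exists (gap_set a N r); split.
    - exact: gap_set_family.
    - exact: card_gap_set.
    - by move=> n; exact: gap_set_ge.
  move=> N; have [->|N0] := posnP N.
    by exists [::]; split=> // n; rewrite ltn0 andbF.
  exists [seq gap_set a k N | k <- iota 0 M]; split.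
  - by rewrite size_map size_iota.
  - by move=> _ /mapP[k _ ->]; exact: gap_set_family.
  - move=> n /(gap_set_cover a_pos aM)[k kM nk].
    apply/hasP; exists (gap_set a k N) => //.
    by apply: map_f; rewrite mem_iota.
apply: contrapT => unb.
have [|D [infD infD' gapD]] := @sparse_for_gap_family a a_pos.
  move=> M; apply: contrapT => /forallNP aM; apply: unb; exists M => n.
  by rewrite leqNgt; apply/negP => /aM.
apply: (sparse_not_almost_greedy (R := R) (F := F) infD infD').
have bas := unit_basis R F (sparse_test1 D).
have [ag_of_family _] := ag 1 ltr01 (lexx 1) _
  (test_banach_separable R F (sparse_test1 D))
  (@unit_vectors_infinite_dimensional R F _ (sparse_test1 D)) _ _ bas.
exact/ag_of_family/sparse_family_almost_greedy.
Qed.
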